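(* Let $4\le m\le n$ be integers. Every octahedral system $\Omega=(V_1,\ldots,V_n,E)$ without isolated vertex and with $|V_1|=|V_2|=\cdots=|V_n|=m$ has at least $\frac{1}{2}m^2+\frac{5}{2}m-11$ edges.
   Context: An $n$-uniform hypergraph is $n$-partite if its vertex set is the disjoint union of $n$ sets $V_1,\ldots,V_n$ and each edge meets each $V_i$ in exactly one vertex; it is written $(V_1,\ldots,V_n,E)$ with $E$ the edge set. An octahedral system is an $n$-uniform $n$-partite hypergraph $(V_1,\ldots,V_n,E)$ with $|V_i|\ge 2$ for all $i$ satisfying the parity condition: for every $X\subseteq\bigcup_i V_i$ with $|X\cap V_i|=2$ for all $i$, the number of edges contained in $X$ is even. A vertex is isolated if it belongs to no edge. *)

(* Defs.v *)
From mathcomp Require Import all_boot all_order all_algebra.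
Set Implicit Arguments.
Unset Strict Implicit.
Unset Printing Implicit Defensive.

(* Hypergraphs live in an ambient finite type T: the vertex set is the union
   of the parts V i, and the edge set E is a set of subsets of it. *)

Definition vertices (T : finType) (n : nat) (V : 'I_n -> {set T}) : {set T} :=
  \bigcup_(i < n) V i.

Definition hypergraph (T : finType) (W : {set T}) (E : {set {set T}}) : Prop :=
  forall e : {set T}, e \in E -> e \subset W.

Definition uniform (T : finType) (n : nat) (E : {set {set T}}) : Prop :=
  forall e : {set T}, e \in E -> #|e| = n.

Definition npartite (T : finType) (n : nat) (V : 'I_n -> {set T})
    (E : {set {set T}}) : Prop :=
  (forall i j : 'I_n, i != j -> [disjoint V i & V j]) /\
  (forall e : {set T}, e \in E -> forall i : 'I_n, #|e :&: V i| = 1).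

Definition parity_condition (T : finType) (n : nat) (V : 'I_n -> {set T})
    (E : {set {set T}}) : Prop :=
  forall X : {set T}, X \subset vertices V ->
    (forall i : 'I_n, #|X :&: V i| = 2) ->
    ~~ odd #|[set e in E | e \subset X]|.

Record octahedral_system (T : finType) (n : nat) (V : 'I_n -> {set T})
    (E : {set {set T}}) : Prop := OctahedralSystem {
  octahedral_hypergraph : hypergraph (vertices V) E;
  octahedral_uniform : uniform n E;
  octahedral_npartite : npartite V E;
  octahedral_card : forall i : 'I_n, 2 <= #|V i|;
  octahedral_parity : parity_condition V E
}.

Definition isolated (T : finType) (E : {set {set T}}) (v : T) : Prop :=
  forall e : {set T}, e \in E -> v \notin e.

Definition no_isolated_vertex (T : finType) (n : nat) (V : 'I_n -> {set T})
    (E : {set {set T}}) : Prop :=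
  forall v : T, v \in vertices V -> ~ isolated E v.

(* Main.v *)
(* In fact |E| >= min (m^2, n(m-2)+2).  Send each vertex to a basis vector and
   each edge to the sum of its vertices; let W be the span of the edges, so that
   dim W <= |E|, and let U_J be W plus the differences of vertices of the same
   part i, for i in J.  Choose I minimising dim U_I - |I|.  By Rado's theorem in
   the quotient by U_I, every edge a has vertices b_j, j outside I, such that
   the b_j - a_j are independent modulo U_I.  Complete b arbitrarily on I: an edge c
   in the octahedron a, b satisfies sum_i (c_i - a_i) in W, so it agrees with a
   outside I.  Parity gives such a c <> a, and varying b on I gives m edges that
   agree with a outside I; in particular I is nonempty, so dim U_I < dim W + |I|.
   If some part j lies outside I, all its m vertices have degree at least m.
   Otherwise dim W > dim U_I - n, while U_I and n-1 vertices of one edge span the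
   whole space of dimension nm, so that nm <= dim W + 2n - 2. *)
Require Import Defs.
From mathcomp Require Import all_boot all_order all_algebra.
From mathcomp Require Import perm zify lra.
Import Order.TTheory GRing.Theory Num.Theory.
Set Implicit Arguments.
Unset Strict Implicit.
Unset Printing Implicit Defensive.

(** * Rado's theorem for submodular set functions *)

Section Rado.
Variables (S I : finType) (r : {set S} -> nat).
Hypothesis r0 : r set0 = 0.
Hypothesis rS : forall A B : {set S}, A \subset B -> r A <= r B.
Hypothesis rU : forall A B : {set S}, r (A :|: B) + r (A :&: B) <= r A + r B.

(* Rado's theorem for a submodular function, by shrinking the sets B i to
   singletons: if neither x nor y can be removed from B i, submodularity applied
   to the two violated Hall conditions gives a contradiction. *)
Lemma rado (s0 : S) (J : {set I}) (B : I -> {set S}) :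
  (forall K : {set I}, K \subset J -> #|K| <= r (\bigcup_(i in K) B i)) ->
  exists2 b : I -> S, forall i, i \in J -> b i \in B i & #|J| <= r (b @: J).
Proof.
have [N] := ubnP (\sum_(i in J) #|B i|); elim: N B => // N IH B ltN hall.
have [/exists_inP[i iJ] | small] := boolP [exists i in J, 1 < #|B i|]; last first.
  have B1 i : i \in J -> exists x, B i = [set x].
    move=> iJ; apply/cards1P; rewrite eqn_leq card_gt0; apply/andP; split.
      by rewrite leqNgt; apply: contra small => ?; apply/exists_inP; exists i.
    apply/eqP => Bi0; have := hall [set i]; rewrite sub1set iJ big_set1 Bi0 r0.
    by rewrite cards1 => /(_ isT).
  (* The default [s0] can occur only for [i] outside [J]. *)
  pose b i := odflt s0 [pick x in B i].
  have Bb i : i \in J -> B i = [set b i].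
    move=> /B1[x Bx]; rewrite /b; case: pickP => [y|]; rewrite Bx.
      by rewrite inE => /eqP->.
    by move/(_ x); rewrite inE eqxx.
  exists b => [i iJ|]; first by rewrite Bb // set11.
  apply: leq_trans (hall J (subxx J)) (rS _).
  apply/bigcupsP => i iJ; rewrite Bb // sub1set; exact: imset_f.
move=> /card_gt1P[x [y [xB yB neq_xy]]].
pose B' z j := if j == i then B i :\ z else B j.
have [/existsP[z /andP[zB /forall_inP hallz]]|none] :=
    boolP [exists z, (z \in B i) &&
             [forall (K : {set I} | K \subset J), #|K| <= r (\bigcup_(j in K) B' z j)]].
  have [|b bB rb] := IH (B' z) _ hallz.
    apply: leq_trans (_ : \sum_(j in J) #|B j| <= N); last by rewrite -ltnS.
    rewrite (bigD1 i) //= [X in _ < X](bigD1 i) //= /B' eqxx.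
    rewrite (cardsD1 z (B i)) zB add1n addSn ltnS leq_add2l.
    by apply: leq_sum => j /andP[_ /negPf->].
  exists b => // j /bB; rewrite /B'; case: eqP => // ->.
  by rewrite inE => /andP[].
(* A set [K] violating Hall's condition after removal of [z] contains [i], because [B' z] agrees
   with [B] at every other index. *)
have bad z : z \in B i -> exists K : {set I},
    [/\ K \subset J, i \in K & r (B i :\ z :|: \bigcup_(j in K :\ i) B j) < #|K|].
  move=> zB; move/existsPn/(_ z): none; rewrite zB /=.
  move=> /forall_inPn[K KJ]; rewrite -ltnNge => ltK; exists K.
  have iK : i \in K.
    apply: contraTT ltK => iK; rewrite -leqNgt.
    rewrite (eq_bigr B) ?hall // => j jK; rewrite /B'.
    by case: eqP jK iK => // -> ->.
  split=> //; apply: leq_trans ltK; rewrite ltnS; apply: rS.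
  rewrite (big_setD1 i iK) /= {1}/B' eqxx; apply: setUS.
  apply/bigcupsP => j jK; apply: (bigcup_max j) => //.
  by rewrite /B'; move: jK; rewrite !inE => /andP[/negPf->].
have [K [KJ iK ltK]] := bad x xB; have [L [LJ iL ltL]] := bad y yB.
set X := _ :|: _ in ltK; set Y := _ :|: _ in ltL; have rXY := rU X Y.
(* As [x] and [y] differ, [X :|: Y] recovers all of [B i], so Hall's condition for [K :|: L]
   applies. *)
have hU : #|K :|: L| <= r (X :|: Y).
  apply: leq_trans (hall _ _) (rS _); first by rewrite subUset KJ.
  apply/bigcupsP => j; have [-> _|ji jKL] := eqVneq j i.
    apply/subsetP => z zB; rewrite !inE zB !andbT.
    by have [->|] := eqVneq z x; rewrite ?neq_xy ?orbT.
  have jX (M : {set I}) : j \in M -> B j \subset \bigcup_(j in M :\ i) B j.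
    by move=> jM; apply: bigcup_sup; rewrite !inE ji.
  case/setUP: jKL => /jX /subsetP jS; apply/subsetP => z /jS zS;
    by rewrite !in_setU zS !orbT.
have hI : #|(K :&: L) :\ i| <= r (X :&: Y).
  apply: leq_trans (hall _ _) (rS _).
    by apply: subset_trans (subD1set _ _) (subset_trans (subsetIl _ _) KJ).
  apply/bigcupsP => j; rewrite !inE => /and3P[ji jK jL].
  by apply/subsetP => z zB; rewrite /X /Y in_setI !in_setU; apply/andP; split;
    apply/orP; right; apply/bigcupP; exists j; rewrite // !inE ji.
(* [hU] and [hI] add up to at least [#|K| + #|L| - 1], whereas [r X + r Y] is at most
   [#|K| + #|L| - 2]. *)
have := cardsUI K L; have := cardsD1 i (K :&: L); rewrite inE iK iL /=.
move: rXY ltK ltL hU hI; lia.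
Qed.

End Rado.

(** * Edges as functions, vertices as basis vectors *)

Section EdgeCount.
Variables (n m : nat) (E : {set {ffun 'I_n -> 'I_m}}).
(* delta_mx i x is the basis vector of the vertex x of part i. *)
Local Notation vT := 'M[rat]_(n, m).

Hypothesis m_gt1 : 1 < m.
(** The form in which parity enters: an octahedron with an even number of edges cannot have [a] as
    its only one. *)
Hypothesis octa : forall a b : {ffun 'I_n -> 'I_m}, a \in E ->
  (forall i, b i != a i) ->
  exists c, [/\ c \in E, c != a & forall i, c i = a i \/ c i = b i].
Hypothesis cover : forall i x, exists2 a, a \in E & a i = x.

Local Open Scope ring_scope.

Definition edge_vec (a : {ffun 'I_n -> 'I_m}) : vT := \sum_i delta_mx i (a i).
Definition edge_span : {vspace vT} := (\sum_(a in E) <[edge_vec a]>)%VS.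
Definition part_diff (i : 'I_n) : {vspace vT} :=
  (\sum_x \sum_y <[delta_mx i x - delta_mx i y]>)%VS.
Definition diff_span (J : {set 'I_n}) : {vspace vT} :=
  (edge_span + \sum_(i in J) part_diff i)%VS.

Lemma mem_part_diff i x y : delta_mx i x - delta_mx i y \in part_diff i.
Proof.
by rewrite memvE (sumv_sup x) // (sumv_sup y).
Qed.

Lemma diff_span_part (J : {set 'I_n}) i x y :
  i \in J -> delta_mx i x - delta_mx i y \in diff_span J.
Proof.
move=> iJ; apply: subv_trans (addvSr _ _).
by apply: (sumv_sup i); rewrite // -memvE mem_part_diff.
Qed.

Lemma dim_sum_lines (S : finType) (A : {set S}) (u : S -> vT) :
  (\dim (\sum_(s in A) <[u s]>)%VS <= #|A|)%N.
Proof.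
rewrite -sum1_card; elim/big_rec2: _ => [|s k V _ IH]; first by rewrite dimv0.
apply: leq_trans (dimv_add_leqif _ _) _; apply: leq_add => //.
by rewrite dim_vline; case: (_ != 0).
Qed.

Lemma mem_sum_lines (S : finType) (A : {set S}) (u : S -> vT) s :
  s \in A -> u s \in (\sum_(s in A) <[u s]>)%VS.
Proof. by move=> sA; rewrite memvE (sumv_sup s). Qed.

(** * Rank modulo a subspace *)

Section Rank.
Variables (S : finType) (P : {vspace vT}) (u : S -> vT).

Definition relspan (X : {set S}) := (P + \sum_(s in X) <[u s]>)%VS.
Definition relrank (X : {set S}) := (\dim (relspan X) - \dim P)%N.

Lemma relspanS (A B : {set S}) : A \subset B -> (relspan A <= relspan B)%VS.
Proof.
move=> AB; apply: addvS => //; apply/subv_sumP => s sA.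
by apply: (sumv_sup s); rewrite // (subsetP AB).
Qed.

Lemma relrank0 : relrank set0 = 0%N.
Proof. by rewrite /relrank /relspan big_set0 addv0 subnn. Qed.

Lemma relrankS (A B : {set S}) : A \subset B -> (relrank A <= relrank B)%N.
Proof. by move=> AB; rewrite leq_sub2r // dimvS // relspanS. Qed.

(** Dimension is modular for sums and intersections of subspaces, and the span of [A :&: B] lies in
    the intersection of the spans. *)
Lemma relrankU (A B : {set S}) :
  (relrank (A :|: B) + relrank (A :&: B) <= relrank A + relrank B)%N.
Proof.
have dP X : (\dim P <= \dim (relspan X))%N by rewrite dimvS ?addvSl.
have UAB : (relspan (A :|: B) <= relspan A + relspan B)%VS.
  rewrite subv_add (subv_trans (addvSl _ _) (addvSl _ _)) /=.
  apply/subv_sumP => s /setUP[] sX.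
    apply: subv_trans (addvSl _ _); apply: subv_trans (addvSr _ _).
    exact: (sumv_sup s).
  apply: subv_trans (addvSr _ _); apply: subv_trans (addvSr _ _).
  exact: (sumv_sup s).
have IAB : (relspan (A :&: B) <= relspan A :&: relspan B)%VS.
  by rewrite subv_cap !relspanS ?subsetIl ?subsetIr.
have := dimvS UAB; have := dimvS IAB; have := dimv_sum_cap (relspan A) (relspan B).
move: (dP A) (dP B) (dP (A :|: B)) (dP (A :&: B)); rewrite /relrank; lia.
Qed.

End Rank.

(** * Consequences of the minimality of [I] *)

Section Minimiser.
Variable I : {set 'I_n}.
(** Adding [#|~: I|] differs from subtracting [#|I|] by the constant [n] and avoids truncated
    subtraction. *)
Hypothesis minI : forall J : {set 'I_n},
  (\dim (diff_span I) + #|~: I| <= \dim (diff_span J) + #|~: J|)%N.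

(** Comparing [I] with [I :|: J] shows that [J] raises the dimension by at least [#|J|]: this is
    Hall's condition for the rank modulo [diff_span I]. *)
Lemma independent_transversal (a : {ffun 'I_n -> 'I_m}) :
  exists b : {ffun 'I_n -> 'I_m}, forall j, j \notin I ->
    delta_mx j (b j) - delta_mx j (a j) \notin
      (diff_span I + \sum_(i in ~: I :\ j) <[delta_mx i (b i) - delta_mx i (a i)]>)%VS.
Proof.
have [n0|ex_i] := posnP n.
  by exists a => j; have := ltn_ord j; rewrite {2}n0.
pose i0 := Ordinal ex_i.
pose u (s : 'I_n * 'I_m) : vT := delta_mx s.1 s.2 - delta_mx s.1 (a s.1).
pose B (i : 'I_n) := [set s : 'I_n * 'I_m | s.1 == i].
have hall (J : {set 'I_n}) : J \subset ~: I ->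
    (#|J| <= relrank (diff_span I) u (\bigcup_(i in J) B i))%N.
  move=> JI.
  have sub : (diff_span (I :|: J) <= relspan (diff_span I) u (\bigcup_(i in J) B i))%VS.
    rewrite subv_add; apply/andP; split.
      exact: subv_trans (addvSl _ _) (addvSl _ _).
    apply/subv_sumP => i; rewrite inE => /orP[iI|iJ].
      apply: subv_trans (addvSl _ _); apply: subv_trans (addvSr _ _).
      exact: (sumv_sup i).
    apply: subv_trans (addvSr _ _).
    (* Differences from the fixed vertex [a i] generate all differences within part [i]. *)
    have mem_u x : u (i, x) \in (\sum_(s in \bigcup_(i in J) B i) <[u s]>)%VS.
      by apply: mem_sum_lines; apply/bigcupP; exists i; rewrite ?inE.
    apply/subv_sumP => x _; apply/subv_sumP => y _.
    have -> : delta_mx i x - delta_mx i y = u (i, x) - u (i, y).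
      by rewrite /u /= opprB addrA subrK.
    by rewrite -memvE rpredB.
  have := minI (I :|: J); have := dimvS sub.
  have := cardsID J (~: I); rewrite (setIidPr JI) setDE -setCU /relrank; lia.
have [b bB rb] := rado (relrank0 _ _) (@relrankS _ _ _) (@relrankU _ _ _)
  (i0, a i0) hall.
(* If the vector of [j] depended on the others, [#|~: I| - 1] vectors would span the transversal
   modulo [diff_span I], against [rb]. *)
exists [ffun i => (b i).2] => j jI; apply: contraL rb => dj.
rewrite -ltnNge; set Q := (_ + _)%VS in dj.
have sub : (relspan (diff_span I) u (b @: ~: I) <= Q)%VS.
  rewrite subv_add addvSl /=; apply/subv_sumP => _ /imsetP[i iI ->].
  have -> : u (b i) = delta_mx i ([ffun i => (b i).2] i) - delta_mx i (a i).
    by have := bB i iI; rewrite inE /u ffunE => /eqP->.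
  rewrite -memvE; have [-> //|ij] := eqVneq i j.
  apply: subv_trans (addvSr _ _).
  apply: (mem_sum_lines (fun i => delta_mx i ([ffun i => (b i).2] i) - delta_mx i (a i))).
  by rewrite !inE ij; rewrite inE in iI.
have dQ : (\dim Q <= \dim (diff_span I) + #|~: I :\ j|)%N.
  by apply: leq_trans (dimv_add_leqif _ _) _; rewrite leq_add2l dim_sum_lines.
have := dimvS sub; have := dimvS (addvSl (diff_span I) (\sum_(s in (b @: ~: I)%SET) <[u s]>)%VS).
have := cardsD1 j (~: I); rewrite inE jI /relrank /relspan; lia.
Qed.

Lemma edge_vecB (a c : {ffun 'I_n -> 'I_m}) :
  edge_vec c - edge_vec a = \sum_i (delta_mx i (c i) - delta_mx i (a i)).
Proof. by rewrite /edge_vec -sumrB. Qed.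

Lemma mem_edge_span (a : {ffun 'I_n -> 'I_m}) : a \in E -> edge_vec a \in edge_span.
Proof. exact: mem_sum_lines. Qed.

Lemma card_agreeing_edges (a : {ffun 'I_n -> 'I_m}) : a \in E ->
  (m <= #|[set c in E | [forall j in ~: I, c j == a j]]|)%N.
Proof.
move=> aE; have [b indep] := independent_transversal a.
pose v0 := Ordinal (ltnW m_gt1).
have b_neq j : j \notin I -> b j != a j.
  by move=> /indep; apply: contra => /eqP->; rewrite subrr mem0v.
(* The label [v0] is reserved for [a] itself: the bijection [tperm (a i) v0] sends [v0] to [a i] and
   every other label to another vertex. *)
have /fin_all_exists[phi phiP] k : exists c : {ffun 'I_n -> 'I_m},
    [/\ c \in E, (k == v0) = (c == a), forall j, j \notin I -> c j = a j &
        forall i, c i = a i \/ c i = tperm (a i) v0 k].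
  have [->|k0] := eqVneq k v0.
    by exists a; rewrite eqxx; split=> // i; left.
  (* On I, the transversals t for distinct k are disjoint, also from a. *)
  pose t := [ffun i => if i \in I then tperm (a i) v0 k else b i].
  have t_neq i : t i != a i.
    rewrite ffunE; case: ifPn => [_|/b_neq//].
    by rewrite -{2}(tpermR (a i) v0) (inj_eq perm_inj).
  have [c [cE ca ct]] := octa aE t_neq.
  (* If [c j] were [b j], cancelling the other terms of [edge_vec c - edge_vec a] would put the
     difference at [j] in the span excluded by [indep]. *)
  have c_off j : j \notin I -> c j = a j.
    move=> jI; case: (ct j) => // cj; rewrite ffunE (negPf jI) in cj.
    have := indep j jI; case/negP; rewrite -cj.
    have -> : delta_mx j (c j) - delta_mx j (a j) = (edge_vec c - edge_vec a)
        - \sum_(i in I) (delta_mx i (c i) - delta_mx i (a i))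
        - \sum_(i in ~: I :\ j) (delta_mx i (c i) - delta_mx i (a i)) :> vT.
      rewrite edge_vecB (bigID (mem I)) /= [X in X - _ - _]addrC addrK.
      rewrite (bigD1 j) //=.
      have eqI i : (i \in ~: I :\ j) = (i \notin I) && (i != j) by rewrite !inE andbC.
      by rewrite (eq_bigl _ _ eqI) addrK.
    apply: rpredB; last first.
      apply: rpred_sum => i; rewrite !inE => /andP[ij iI].
      have [->|ci] := ct i; first by rewrite subrr rpred0.
      rewrite ffunE (negPf iI) in ci; rewrite ci.
      apply: subv_trans (addvSr _ _).
      apply: (mem_sum_lines (fun i => delta_mx i (b i) - delta_mx i (a i))).
      by rewrite !inE ij.
    apply: subv_trans (addvSl _ _); rewrite -memvE.
    apply: rpredB; last by apply: rpred_sum => i iI; apply: diff_span_part.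
    by apply: subv_trans (addvSl _ _); rewrite -memvE rpredB // mem_edge_span.
  exists c; rewrite (negPf ca); split=> // i.
  have [iI|/c_off->] := boolP (i \in I); last by left.
  by case: (ct i); rewrite ?ffunE ?iI; [left|right].
have phi_inj : injective phi.
  move=> k l kl; have [_ ka _ kt] := phiP k; have [_ la _ lt] := phiP l.
  have [k0|k0] := eqVneq k v0; first by apply/eqP; rewrite k0 eq_sym la -kl -ka k0.
  (* The edge [phi k] departs from [a] at some [i], and its value there determines the label. *)
  have : phi k != a by rewrite -ka.
  move=> /eqP neq; have [/existsP[i ki]|] := boolP [exists i, phi k i != a i].
    have := lt i; rewrite -kl; move/eqP: ki => ki [//|li].
    have [//|] := kt i; by rewrite li => /perm_inj.
  move=> /existsPn none; case: neq; apply/ffunP => i.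
  by have := none i; rewrite negbK => /eqP.
rewrite -[X in (X <= _)%N]card_ord -(card_imset predT phi_inj) subset_leq_card //.
apply/subsetP => _ /imsetP[k _ ->]; have [kE _ koff _] := phiP k.
by rewrite inE kE; apply/forall_inP => j; rewrite inE => /koff->.
Qed.

End Minimiser.

Lemma card_edges_ffun : (0 < n)%N ->
  (m * m <= #|E|)%N \/ (n * m + 2 <= #|E| + 2 * n)%N.
Proof.
move=> n_gt0; pose i0 := Ordinal n_gt0; pose v0 := Ordinal (ltnW m_gt1).
pose w J := (\dim (diff_span J) + #|~: J|)%N.
have [I _ minI] := @arg_minnP _ set0 predT w isT.
have {}minI J : (w I <= w J)%N by exact: minI.
have [a aE _] := cover i0 v0.
(* Were the empty set a minimiser, [m > 1] edges would agree with [a] everywhere. *)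
have wI : (w I < w set0)%N.
  rewrite ltn_neqAle minI andbT; apply/eqP => eqw.
  have min0 J : (w set0 <= w J)%N by rewrite -eqw.
  have := card_agreeing_edges min0 aE; rewrite leqNgt => /negP[].
  apply: leq_ltn_trans m_gt1; rewrite -(cards1 a) subset_leq_card //.
  apply/subsetP => c; rewrite !inE => /andP[_ /forall_inP ca].
  by apply/eqP/ffunP => i; apply/eqP/ca; rewrite !inE.
have [|] := eqVneq I setT; last first.
  rewrite -properT => /properP[_ [j _ jI]]; left.
  have deg x : (m <= #|[set c in E | c j == x]|)%N.
    have [c cE cj] := cover j x.
    apply: leq_trans (card_agreeing_edges minI cE) (subset_leq_card _).
    apply/subsetP => d; rewrite !inE => /andP[-> /forall_inP/(_ j)].
    by rewrite inE jI cj => ->.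
  (* Sorting the edges by their vertex in part [j] gives [m] classes of size at least [m]. *)
  rewrite -sum1_card (partition_big (fun c : {ffun 'I_n -> 'I_m} => c j) predT) //=.
  rewrite -{1}(card_ord m) -sum_nat_const; apply: leq_sum => x _.
  by apply: leq_trans (deg x) _; rewrite -sum1_card; apply/eq_leq/eq_bigl => c; rewrite inE.
move=> IT; right.
(* The vertex of [a] in part [i0] is the edge minus its other vertices, so [n - 1] extra vectors
   suffice. *)
have full : (fullv <= diff_span I +
    \sum_(i in [set~ i0]) <[delta_mx i (a i) : vT]>)%VS.
  set Q := (_ + _)%VS.
  have dQ i x y : delta_mx i x - delta_mx i y \in Q.
    by apply: subv_trans (addvSl _ _); apply: diff_span_part; rewrite IT inE.
  have aQ i : i != i0 -> delta_mx i (a i) \in Q.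
    move=> ii0; apply: subv_trans (addvSr _ _).
    by apply: (mem_sum_lines (fun i => delta_mx i (a i))); rewrite !inE.
  have a0Q : delta_mx i0 (a i0) \in Q.
    have -> : delta_mx i0 (a i0) =
        edge_vec a - \sum_(i | i != i0) delta_mx i (a i) :> vT.
      by rewrite /edge_vec (bigD1 i0) //= addrK.
    apply: rpredB; last by apply: rpred_sum.
    by do 2!apply: subv_trans (addvSl _ _); rewrite -memvE mem_edge_span.
  apply/subvP => M _; rewrite (matrix_sum_delta M).
  apply: rpred_sum => i _; apply: rpred_sum => x _; apply: rpredZ.
  rewrite -(subrK (delta_mx i (a i)) (delta_mx i x)) rpredD //.
  by have [->|/aQ] := eqVneq i i0.
have dFull := leq_trans (dimvS full) (dimv_add_leqif _ _).
have {}dFull : (n * m <= \dim (diff_span setT) + n.-1)%N.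
  rewrite dimvf dim_matrix IT in dFull; apply: leq_trans dFull _.
  rewrite leq_add2l; apply: leq_trans (dim_sum_lines _ _) _.
  by rewrite cardsC1 card_ord.
have dE : (\dim edge_span <= #|E|)%N by apply: dim_sum_lines.
have dS : w setT = \dim (diff_span setT) by rewrite /w setCT cards0 addn0.
have d0 : w set0 = (\dim edge_span + n)%N.
  by rewrite /w /diff_span big_set0 addv0 setC0 cardsT card_ord.
(* The strict inequality [wI] and the [n.-1] in [dFull] each save one, whence the [+ 2]. *)
rewrite IT dS d0 in wI; clear - dFull dE wI n_gt0.
move: dFull dE wI n_gt0.
generalize (\dim (diff_span setT)) (\dim edge_span) #|E| (n * m)%N; lia.
Qed.

End EdgeCount.

(** * Translation of octahedral systems into coordinates *)

Section Coordinates.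
Variables (m n : nat) (T : finType) (V : 'I_n -> {set T}) (E : {set {set T}}).
Hypothesis hO : octahedral_system V E.
Hypothesis hiso : no_isolated_vertex V E.
Hypothesis hcard : forall i : 'I_n, #|V i| = m.

Definition vertex (i : 'I_n) (k : 'I_m) : T := enum_val (cast_ord (esym (hcard i)) k).
Definition transversal_set (a : {ffun 'I_n -> 'I_m}) : {set T} := [set vertex i (a i) | i : 'I_n].
Definition edge_ffuns : {set {ffun 'I_n -> 'I_m}} := [set a | transversal_set a \in E].

Lemma vertex_in i k : vertex i k \in V i.
Proof. exact: enum_valP. Qed.

Lemma vertex_inj i : injective (vertex i).
Proof. by move=> k l /enum_val_inj/cast_ord_inj. Qed.

Lemma vertex_surj i x : x \in V i -> exists k, vertex i k = x.
Proof.
move=> xV; exists (cast_ord (hcard i) (enum_rank_in xV x)).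
by rewrite /vertex cast_ordK enum_rankK_in.
Qed.

Lemma part_uniq i j x : x \in V i -> x \in V j -> i = j.
Proof.
move=> xi xj; apply/eqP/negP => /negP ij.
have [/(_ i j ij) dis _] := octahedral_npartite hO.
by have := disjointFr dis xi; rewrite xj.
Qed.

Lemma mem_transversal_set a i k : (vertex i k \in transversal_set a) = (k == a i).
Proof.
apply/imsetP/eqP => [[j _ e]|->]; last by exists i.
have ij : i = j by apply: (@part_uniq _ _ (vertex i k)); rewrite ?vertex_in // e vertex_in.
by move: e; rewrite -ij => /vertex_inj.
Qed.

Lemma transversal_set_inj : injective transversal_set.
Proof.
move=> a b ab; apply/ffunP => i; apply/eqP.
by rewrite -mem_transversal_set -ab mem_transversal_set.
Qed.

Lemma edge_transversal e : e \in E -> exists a, transversal_set a = e.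
Proof.
move=> eE; have [_ /(_ e eE) one] := octahedral_npartite hO.
have /fin_all_exists[a aP] i : exists k, e :&: V i = [set vertex i k].
  have /eqP/cards1P[x ex] := one i; rewrite ex.
  have : x \in e :&: V i by rewrite ex set11.
  by rewrite inE => /andP[_ /vertex_surj[k <-]]; exists k.
exists [ffun i => a i]; apply/setP => x; apply/imsetP/idP => [[i _ ->]|xe].
  have : vertex i (a i) \in e :&: V i by rewrite aP set11.
  by rewrite inE ffunE => /andP[].
have /bigcupP[i _ xi] := subsetP (octahedral_hypergraph hO eE) x xe.
by exists i => //; rewrite ffunE; apply/set1P; rewrite -aP inE xe.
Qed.

Lemma card_edge_ffuns : #|edge_ffuns| <= #|E|.
Proof.
rewrite -(card_imset _ transversal_set_inj) subset_leq_card //.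
by apply/subsetP => _ /imsetP[a + ->]; rewrite inE.
Qed.

Lemma edge_ffuns_cover i x : exists2 a, a \in edge_ffuns & a i = x.
Proof.
have [/exists_inP[e eE xe]|] := boolP [exists e in E, vertex i x \in e].
  have [a ae] := edge_transversal eE; exists a; first by rewrite inE ae.
  by move: xe; rewrite -ae mem_transversal_set => /eqP.
move=> /exists_inPn none; have [|e eE] := hiso (v := vertex i x); last exact: none.
by apply/bigcupP; exists i; rewrite ?vertex_in.
Qed.

Lemma edge_ffuns_octahedron (a b : {ffun 'I_n -> 'I_m}) : 0 < n -> a \in edge_ffuns ->
  (forall i, b i != a i) ->
  exists c, [/\ c \in edge_ffuns, c != a & forall i, c i = a i \/ c i = b i].
Proof.
move=> n_gt0; rewrite inE => aE ba; set X := transversal_set a :|: transversal_set b.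
have memX i k : (vertex i k \in X) = (k \in [set a i; b i]).
  by rewrite !inE !mem_transversal_set.
have XV : X \subset vertices V.
  apply/subsetP => x; rewrite inE => /orP[] /imsetP[i _ ->];
    by apply/bigcupP; exists i; rewrite ?vertex_in.
have X2 i : #|X :&: V i| = 2.
  have -> : X :&: V i = vertex i @: [set a i; b i].
    apply/setP => x; rewrite inE; apply/andP/imsetP => [[xX /vertex_surj[k kx]]|[k kab ->]].
      by exists k; rewrite // -memX kx.
    by rewrite memX vertex_in.
  by rewrite (card_imset _ (@vertex_inj i)) cards2 eq_sym ba.
have := octahedral_parity hO XV X2.
set F := [set e in E | e \subset X]; have aF : transversal_set a \in F.
  by rewrite inE aE subsetUl.
(* Without the edge of [a], the even count becomes odd, hence positive. *)
rewrite (cardsD1 (transversal_set a)) aF /= negbK => /odd_gt0/card_gt0P[e].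
rewrite !inE => /and3P[ea eE eX].
have [c ce] := edge_transversal eE; exists c; split; first by rewrite inE ce.
  by apply: contraNneq ea => <-; rewrite ce.
move=> i; have : vertex i (c i) \in X by rewrite (subsetP eX) // -ce mem_transversal_set.
by rewrite memX => /set2P.
Qed.

Lemma card_edges : 1 < m -> 0 < n -> m * m <= #|E| \/ n * m + 2 <= #|E| + 2 * n.
Proof.
move=> m_gt1 n_gt0; have leE := card_edge_ffuns.
have oct a b aE ba := @edge_ffuns_octahedron a b n_gt0 aE ba.
case: (card_edges_ffun m_gt1 oct edge_ffuns_cover n_gt0); [left | right].
  exact: leq_trans leE.
by apply: leq_trans (_ : _ <= #|edge_ffuns| + 2 * n) _; rewrite ?leq_add2r.
Qed.

End Coordinates.

(** * Comparison with the quadratic bound *)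

Theorem theorem1p1 (m n : nat) (hm : 4 <= m) (hmn : m <= n)
    (T : finType) (V : 'I_n -> {set T}) (E : {set {set T}})
    (hO : octahedral_system V E)
    (hiso : no_isolated_vertex V E)
    (hcard : forall i : 'I_n, #|V i| = m) :
  (1 / 2%:R * m%:R ^+ 2 + 5%:R / 2%:R * m%:R - 11%:R <= #|E|%:R :> rat)%R.
Proof.
have le2 : (m * m + 5 * m <= 2 * #|E| + 22)%N.
  have m_gt1 : 1 < m by lia.
  have n_gt0 : 0 < n by lia.
  (* This is [(n - m) * (m - 2) >= 0], which reduces the second alternative to [n = m]. *)
  have mm : n * m >= m * m + 2 * (n - m) by nia.
  (* Twice [m^2 - 2m + 2] exceeds [m^2 + 5m - 22] by [m^2 - 9m + 26], of negative discriminant. *)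
  have : m * m + 26 >= 9 * m by nia.
  by case: (card_edges hO hiso hcard m_gt1 n_gt0); lia.
rewrite -(ler_pM2l (ltr0n _ 2)); move: le2.
rewrite -(ler_nat rat) !natrD !natrM; lra.
Qed.
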